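(* For all integers $n,\lambda,r\ge 0$ and $m,x\ge 1$, $$D^{\lambda,x}_{m,r}(n+1)=r\,D^{\lambda,x}_{m,r}(n)+x\lambda\sum_{i=0}^{n}\binom{n}{i}m^{i}\,D^{\lambda,x}_{m,r}(n-i).$$
   Context: For integers $n,r,\lambda\ge 0$ and $m,x\ge 1$, $D^{\lambda,x}_{m,r}(n)$ (the higher order non-degenerate $r$-Dowling polynomial) is the number of $(r,m,x,\lambda)$-partitions of $\{1,\ldots,n+r\}$, i.e. set partitions of $\{1,\ldots,n+r\}$ carrying the following extra data. (i) The elements $1,\ldots,r$ lie in $r$ distinct blocks, called distinguished blocks; all other blocks are called non-distinguished. (ii) In each non-distinguished block every element except the largest one is colored independently with one of $m$ colors. (iii) Each non-distinguished block is colored independently with one of $x$ colors. (iv) Each non-distinguished block is assigned independently to one of $\lambda$ sections. (v) Neither the distinguished blocks nor their elements are colored. *)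

(* Defs.v *)
From mathcomp Require Import all_boot.

Set Implicit Arguments.
Unset Strict Implicit.
Unset Printing Implicit Defensive.

(* The ground set {1, ..., n + r} is 'I_(n + r): the ordinal of value k stands
   for the element k + 1, so the elements 1, ..., r are the ordinals < r. *)
Section RPartitions.
Variables n r m x lambda : nat.
Implicit Types (P : {set {set 'I_(n + r)}}) (B : {set 'I_(n + r)}).

Definition distinguished B : bool := [exists e in B, e < r].

Definition largest B (e : 'I_(n + r)) : bool :=
  (e \in B) && [forall f in B, f <= e].

Definition r_partition P : bool :=
  partition P [set: 'I_(n + r)] &&
  [forall i : 'I_(n + r), forall j : 'I_(n + r),
     [&& i < r, j < r & i != j] ==> (pblock P i != pblock P j)].

(* A set of blocks, an element coloring, a block coloring, and an assignment of
   blocks to sections. The last three are partial functions, with value None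
   off their domain, so that each (r, m, x, lambda)-partition is represented
   exactly once. *)
Definition decorated : finType :=
  ({set {set 'I_(n + r)}} *
   {ffun 'I_(n + r) -> option 'I_m} *
   {ffun {set 'I_(n + r)} -> option 'I_x} *
   {ffun {set 'I_(n + r)} -> option 'I_lambda})%type.

Definition is_rmxl_partition (t : decorated) : bool :=
  let: (P, elt_color, block_color, section) := t in
  [&& r_partition P,
      [forall e, (elt_color e != None) ==
         [exists B in P, [&& e \in B, ~~ distinguished B & ~~ largest B e]]],
      [forall B, (block_color B != None) == ((B \in P) && ~~ distinguished B)] &
      [forall B, (section B != None) == ((B \in P) && ~~ distinguished B)]].

End RPartitions.

Definition Dowling (lambda x m r n : nat) : nat :=
  #|[set t | @is_rmxl_partition n r m x lambda t]|.

(* Main.v *)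
Require Import Defs.
From mathcomp Require Import all_boot.

(** The idea is to trade decorations for weights. Given the underlying set
partition P, the decorations of different blocks are independent, so the number
of decorated partitions above P is a product over the blocks: a distinguished
block contributes 1 and any other block B contributes x lambda m^(|B| - 1).
This last number no longer mentions the largest element, so the order on the
ground set disappears. The requirement that the r special elements lie in
different blocks is absorbed too, by giving weight 0 to a block with two of
them. Hence [Dowling] is a sum, over all set partitions of a set A, of a product
of block weights ([Dowling_weighted]).

For such a sum, removing the block of one chosen element a gives the recurrence
[weighted_partitions_rec]. Take a to be non-special, and write its block as a
together with a set C.
- If C has no special element, the block weighs x lambda m^|C| and what is left
  is a partition of the remaining non-special elements and all r special ones.
  Grouping the sets C by size gives the sum with binomial coefficients.
- If C has exactly one special element p, the block weighs 1, and so does C.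
  The blocks are thus those of p in a partition of A minus a, and the same
  recurrence, read backwards at p, sums them to the total for A minus a.
  The r choices of p give the term r D(n).
This is [dowling_weight_rec].

What is left after removing C lives in a subset of the ground set and not in
some 'I_(k + r), so one also needs that the weighted sum depends only on the
numbers of special and non-special elements ([Dowling_depends_on_sizes]). This
follows by strong induction from the same recurrence, whose right-hand side
only involves smaller sums. *)

Set Implicit Arguments.
Unset Strict Implicit.
Unset Printing Implicit Defensive.

(** * Weighted sums over set partitions *)

Section WeightedPartitions.
Variable T : finType.
Implicit Types (v : {set T} -> nat) (A C U : {set T}) (a : T).

Definition weighted_partitions v A : nat :=
  \sum_(P : {set {set T}} | partition P A) \prod_(B in P) v B.

Lemma weighted_partitions0 v : weighted_partitions v set0 = 1.
Proof.
rewrite /weighted_partitions (eq_bigl (pred1 set0)) => [|P].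
  by rewrite big_pred1_eq big_set0.
by rewrite partition_set0.
Qed.

(** A partition of A is its block containing a together with a partition of the
complement of that block. The block is indexed by C, its part other than a. *)
Lemma weighted_partitions_rec v A a : a \in A ->
  weighted_partitions v A =
  \sum_(C : {set T} | C \subset A :\ a)
    v (a |: C) * weighted_partitions v (A :\ a :\: C).
Proof.
move=> aA; rewrite /weighted_partitions.
have blockK (P : {set {set T}}) : partition P A ->
    a |: pblock P a :\ a = pblock P a /\ pblock P a \in P.
  move=> partP; have aP: a \in cover P by rewrite (cover_partition partP).
  by rewrite setD1K ?mem_pblock // pblock_mem.
rewrite (partition_big (fun P => pblock P a :\ a)
                       (fun C => C \subset A :\ a)) /=; last first.
  move=> P partP; have [_ aP] := blockK P partP; apply: setSD.
  by rewrite -(cover_partition partP) (bigcup_max (pblock P a)).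
apply: eq_bigr => C sCA; have aC: a \notin C.
  by apply/negP => /(subsetP sCA); rewrite !inE eqxx.
rewrite big_distrr /= (reindex_onto (fun Q => (a |: C) |: Q)
                                    (fun P => P :\ (a |: C))) /=; last first.
  by move=> P /andP[/blockK[eqB BP] /eqP<-]; rewrite eqB setD1K.
have ->: A :\ a :\: C = A :\: (a |: C) by rewrite setDDl.
have sBA: a |: C \subset A.
  by rewrite subUset sub1set aA (subset_trans sCA) ?subsetDl.
have Bn0: a |: C != set0 by apply/set0Pn; exists a; rewrite setU11.
apply: eq_big => [Q | Q /andP[_ /eqP eqQ]]; last first.
  by rewrite big_setU1 // -eqQ !inE eqxx.
apply/idP/idP => [/andP[/andP[partQ _] /eqP<-] | partQ].
  by apply: partitionD1 => //; rewrite setU11.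
have BQ: a |: C \notin Q.
  apply/negP => BQ; have: a \in cover Q.
    by apply/bigcupP; exists (a |: C); rewrite ?setU11.
  by rewrite (cover_partition partQ) !inE eqxx.
have dBQ: [disjoint a |: C & A :\: (a |: C)].
  by rewrite -setI_eq0 setIDA setIC -setIDA setDv setI0.
have partBQ: partition ((a |: C) |: Q) A.
  rewrite -[A](setID A (a |: C)) (setIidPr sBA).
  exact: partitionU1 partQ Bn0 dBQ.
rewrite partBQ (def_pblock (partition_trivIset partBQ) (setU11 _ _)) ?setU11 //.
by rewrite !setU1K ?eqxx.
Qed.

Lemma sum_subset_card U (f : nat -> nat) :
  \sum_(C : {set T} | C \subset U) f #|C| =
  \sum_(0 <= i < #|U|.+1) 'C(#|U|, i) * f i.
Proof.
rewrite big_mkord (partition_big (fun C => inord #|C| : 'I_#|U|.+1) xpredT) //.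
apply: eq_bigr => i _; rewrite -cards_draws -sum_nat_const.
rewrite (eq_bigl (fun C => C \in [set D : {set T} | D \subset U & #|D| == i]))
  => [|C].
  by apply: eq_bigr => C; rewrite !inE => /andP[_ /eqP->].
rewrite !inE; case sCU: (C \subset U) => //=.
by rewrite -val_eqE /= inordK // ltnS subset_leq_card.
Qed.

End WeightedPartitions.

(** * The weight of a block and its recurrence *)

Section DowlingWeights.
Variables (lambda m x : nat) (T : finType).
Implicit Types (A B C R : {set T}) (a : T).

(** R is the set of special elements 1, ..., r. The last value is a boolean read
as 0 or 1: a block with one special element is a distinguished block, without
decoration, and a block with several of them is forbidden. *)
Definition block_weight R B : nat :=
  if B :&: R == set0 then x * lambda * m ^ #|B|.-1 else #|B :&: R| == 1.

(** The sum is written over all special elements of C, and not as a case on their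
number, so that it can be exchanged with the sum over C. It has one term when
[block_weight R C] is 1, and only null terms when C has several special
elements. *)
Lemma block_weightU1 R C a : a \notin R -> a \notin C ->
  block_weight R (a |: C) =
    (if C :&: R == set0 then x * lambda * m ^ #|C| else 0)
    + \sum_(p in R | p \in C) block_weight R C.
Proof.
move=> aR aC; have aI: (a |: C) :&: R = C :&: R.
  by rewrite setIUl [X in X :|: _](_ : _ = set0) ?set0U //; apply/setP => y;
    rewrite !inE; case: eqP => // ->; apply: negbTE.
rewrite (eq_bigl (fun p => p \in C :&: R)) => [|y]; last by rewrite !inE andbC.
rewrite sum_nat_const /block_weight aI cardsU1 aC add1n /=.
case: eqP => [-> | _]; first by rewrite cards0 addn0.
by case: eqP => [-> | _]; rewrite ?muln0.
Qed.

(** Only the partition into singletons avoids putting two special elements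
together. *)
Lemma dowling_weight_distinguished R A : A \subset R ->
  weighted_partitions (block_weight R) A = 1.
Proof.
elim: {A}#|A| {-2}A (eqxx #|A|) => [|k IHk] A.
  by rewrite cards_eq0 => /eqP->; rewrite weighted_partitions0.
move=> cA sAR; have /set0Pn[a aA]: A != set0 by rewrite -card_gt0 (eqP cA).
rewrite (weighted_partitions_rec _ aA) (bigD1 set0) ?sub0set //=.
rewrite big1 => [|C /andP[sCA Cn0]].
  have aR: a \in R by apply: (subsetP sAR).
  rewrite setU0 setD0 IHk.
  - by rewrite /block_weight (setIidPl _) ?sub1set // cards1 -cards_eq0 cards1.
  - by rewrite (cardsD1 a) aA in cA.
  - by rewrite (subset_trans _ sAR) ?subsetDl.
have aC: a \notin C by apply/negP => /(subsetP sCA); rewrite !inE eqxx.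
have sBR: a |: C \subset R.
  by rewrite (subset_trans _ sAR) // subUset sub1set aA
    (subset_trans sCA) ?subsetDl.
rewrite /block_weight (setIidPl sBR) -cards_eq0 cardsU1 aC /= eqSS.
by rewrite cards_eq0 (negbTE Cn0).
Qed.

(** The first term counts the partitions where a shares its block with a special
element p: erasing a from that block leaves a partition of A :\ a of the same
weight. The second one counts those where a lies in a block a |: C without
special elements. *)
Lemma dowling_weight_rec R A a : R \subset A -> a \in A :\: R ->
  weighted_partitions (block_weight R) A =
    #|R| * weighted_partitions (block_weight R) (A :\ a)
    + x * lambda * \sum_(C : {set T} | C \subset A :\: R :\ a)
        m ^ #|C| * weighted_partitions (block_weight R) (A :\ a :\: C).
Proof.
move=> sRA; rewrite inE => /andP[aR aA].
rewrite (weighted_partitions_rec _ aA).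
pose W := weighted_partitions (block_weight R); rewrite -/W.
transitivity (\sum_(C : {set T} | C \subset A :\ a)
   ((if C :&: R == set0 then x * lambda * m ^ #|C| else 0) * W (A :\ a :\: C)
    + \sum_(p in R | p \in C) block_weight R C * W (A :\ a :\: C))).
  apply: eq_bigr => C sCA; rewrite block_weightU1 ?mulnDl ?big_distrl //.
  by apply/negP => /(subsetP sCA); rewrite !inE eqxx.
rewrite big_split /= addnC; congr (_ + _).
  rewrite (exchange_big_dep (fun p => p \in R)) => [|C p _ /andP[]//] /=.
  rewrite -sum_nat_const; apply: eq_bigr => p pR.
  have pA: p \in A :\ a.
    by rewrite !inE (subsetP sRA) // andbT; apply: contraNneq aR => <-.
  (* On the left C runs over the sets containing p; on the right the block of p
     is written p |: D. *)
  rewrite /W (weighted_partitions_rec _ pA).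
  rewrite (reindex_onto (fun D => p |: D) (fun C => C :\ p)); last first.
    by move=> C /and3P[_ _ pC]; rewrite setD1K.
  apply: eq_big => [D | D _]; last by rewrite [in RHS](setDDl (A :\ a)).
  rewrite pR setU11 !andbT subUset sub1set pA /= [RHS]subsetD1; congr (_ && _).
  by apply/eqP/idP => [<-|/setU1K//]; rewrite !inE eqxx.
rewrite big_distrr /= [LHS](bigID (fun C => C :&: R == set0)) /=.
rewrite [X in _ + X]big1 ?addn0 => [|C /andP[_ /negbTE->] //].
apply: eq_big => [C | C /andP[_ ->]]; last by rewrite mulnA.
by rewrite setI_eq0 -subsetD !setDDl (setUC R).
Qed.

End DowlingWeights.

(** * Counting decorations *)

Lemma card_partial_functions (aT rT : finType) (Q : pred aT) :
  \sum_(f : {ffun aT -> option rT}) [forall a, (f a != None) == Q a] =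
  #|rT| ^ #|Q|.
Proof.
have <-: #|predC1 (None : option rT)| = #|rT| by rewrite cardC1 card_option.
rewrite -(card_pffun_on None) -sum1_card [RHS]big_mkcond /=.
apply: eq_bigr => f _; rewrite -[RHS]/(nat_of_bool (f \in _)).
congr (nat_of_bool _); apply/forallP/pffun_onP => [fQ | [sfQ fSome] a].
  split=> [|_ /imageP[a Qa ->]]; last by rewrite !inE (eqP (fQ a)).
  by apply/subsetP => a; rewrite inE (eqP (fQ a)).
apply/eqP; apply/idP/idP => [fa | Qa]; first by apply: (subsetP sfQ); rewrite inE.
by have := fSome _ (image_f f Qa); rewrite !inE.
Qed.

Section DecoratedPartitions.
Variables n r m x lambda : nat.
Notation elt := 'I_(n + r).
Notation R := [set i : elt | i < r].
Implicit Types (P : {set {set elt}}) (B : {set elt}).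

Lemma distinguishedE B : distinguished B = (B :&: R != set0).
Proof.
apply/exists_inP/set0Pn => -[e]; first by exists e; rewrite !inE; apply/andP.
by rewrite !inE => /andP[eB er]; exists e.
Qed.

Lemma r_partitionE P : r_partition (r := r) P =
  partition P setT && [forall B in P, #|B :&: R| <= 1].
Proof.
rewrite /r_partition; case partP: (partition P _) => //=.
have trivP := partition_trivIset partP.
have coverP i : i \in cover P by rewrite (cover_partition partP) inE.
apply/forallP/forall_inP => [sepP B BP | sepP i].
  apply/card_le1_eqP => i j; rewrite !inE => /andP[iB ir] /andP[jB jr].
  apply/eqP; have /forallP/(_ j) := sepP i.
  rewrite ir jr /= (def_pblock trivP BP iB) (def_pblock trivP BP jB) eqxx.
  by rewrite eq_sym; case: (j == i).
apply/forallP => j; apply/implyP => /and3P[ir jr]; apply: contra => /eqP eqij.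
have /card_le1_eqP le1 := sepP _ (pblock_mem (coverP i)).
have jP: j \in pblock P i by rewrite eqij mem_pblock.
by apply/eqP/le1; rewrite !inE ?ir ?jr ?jP ?mem_pblock ?coverP.
Qed.

(** The choice of the uncolored element disappears here: whichever element
is the largest, exactly one element of a nonempty block is not colored. *)
Lemma card_not_largest B : #|[set e in B | ~~ largest B e]| = #|B|.-1.
Proof.
have [->|/set0Pn[e0 e0B]] := eqVneq B set0.
  rewrite cards0; apply/eqP; rewrite cards_eq0; apply/eqP/setP => e.
  by rewrite !inE.
have [e eB emax] := arg_maxnP (fun e : elt => val e) e0B.
have maxe f : f \in B -> f <= e by exact: emax.
rewrite (cardsD1 e B) [e \in B]eB add1n /=.
congr #|pred_of_set _|; apply/setP => f.
rewrite !inE andbC; case fB: (f \in B); rewrite ?andbF //= !andbT.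
congr (~~ _); rewrite /largest fB /=; apply/forall_inP/eqP => [maxf | -> //].
by apply: val_inj; apply/eqP; rewrite eqn_leq maxe // maxf.
Qed.

(** The colored elements of a partition split according to their blocks, so the
number of element colorings is a product over the blocks. *)
Lemma card_colorable P : partition P setT ->
  m ^ #|[pred e | [exists B in P,
           [&& e \in B, ~~ distinguished B & ~~ largest B e]]]| =
  \prod_(B in P) (if distinguished B then 1 else m ^ #|B|.-1).
Proof.
move=> partP; have trivP := partition_trivIset partP.
rewrite -prod_nat_const big_mkcond /=.
pose F e := if [exists B in P,
  [&& e \in B, ~~ distinguished B & ~~ largest B e]] then m else 1.
rewrite -[LHS]/(\prod_e F e) (eq_bigl (fun e => e \in cover P)); last first.
  by move=> e; rewrite (cover_partition partP) inE.
rewrite big_trivIset //=; apply: eq_bigr => B BP.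
have FE e : e \in B ->
    F e = if ~~ distinguished B && ~~ largest B e then m else 1.
  move=> eB; rewrite /F; congr (if _ then _ else _).
  apply/exists_inP/idP => [[C CP /and3P[eC ?]] | ?]; last first.
    by exists B; rewrite // eB.
  by rewrite -(def_pblock trivP BP eB) (def_pblock trivP CP eC) => ->; apply/andP.
rewrite (eq_bigr _ FE); case: (distinguished B) => /=; first by rewrite big1.
rewrite -big_mkcondr -card_not_largest -prod_nat_const.
by apply: eq_bigl => e; rewrite inE.
Qed.

(** For a fixed P, the three colorings are independent partial functions with
prescribed domains. When P puts two special elements together there is no
decoration, and the product of weights has a null factor. *)
Lemma Dowling_weighted :
  Dowling lambda x m r n =
  weighted_partitions (block_weight lambda m x R) [set: elt].
Proof.
rewrite /Dowling -sum1_card.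
transitivity (\sum_P \sum_c \sum_b \sum_s
    (@is_rmxl_partition n r m x lambda (P, c, b, s) : nat)).
  rewrite !pair_bigA /= big_mkcond; apply: eq_bigr => -[[[P c] b] s] _ /=.
  by rewrite inE /=; case: [&& _, _, _ & _].
rewrite /weighted_partitions [RHS]big_mkcond; apply: eq_bigr => P _.
pose Qc := [pred e | [exists B in P,
   [&& e \in B, ~~ distinguished (r := r) B & ~~ largest B e]]].
pose Qb := [pred B | (B \in P) && ~~ distinguished (r := r) B].
transitivity (r_partition (r := r) P *
              (m ^ #|Qc| * (x ^ #|Qb| * lambda ^ #|Qb|))).
  have count (aT : finType) k (Q : pred aT) :=
    etrans (card_partial_functions 'I_k Q) (congr1 (expn^~ #|Q|) (card_ord k)).
  rewrite -!count !(big_distrl, big_distrr) /=.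
  apply: eq_bigr => c _; rewrite !(big_distrl, big_distrr) /=.
  apply: eq_bigr => b _; rewrite !(big_distrl, big_distrr) /=.
  by apply: eq_bigr => s _; rewrite !mulnb.
rewrite r_partitionE; case: ifP => partP //=.
rewrite card_colorable // -expnMn -prod_nat_const big_mkcondr /= -big_split.
case: forall_inP => [sepP | /forall_inP/forall_inPn[B BP]]; last first.
  rewrite -ltnNge => gt1; rewrite [RHS](bigD1 B) //= /block_weight.
  by rewrite -cards_eq0 !gtn_eqF // ltnW.
rewrite mul1n; apply: eq_bigr => B BP.
rewrite /block_weight distinguishedE; case: eqP => [_ | /eqP Bn0] /=.
  by rewrite mulnC.
by rewrite eqn_leq sepP // card_gt0 Bn0.
Qed.

End DecoratedPartitions.

(** * The recurrence for Dowling numbers *)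

Lemma weighted_ground_set (lambda m x r n : nat) :
  exists R : {set 'I_(n + r)}, [/\ #|R| = r, #|setT :\: R| = n &
    Dowling lambda x m r n =
      weighted_partitions (block_weight lambda m x R) setT].
Proof.
have cR: #|[set i : 'I_(n + r) | i < r]| = r.
  by rewrite cardsE -sum1_card (big_ord_narrow (leq_addl n r)) sum1_card card_ord.
exists [set i : 'I_(n + r) | i < r]; split; last exact: Dowling_weighted.
- exact: cR.
- by rewrite cardsD setTI cardsT card_ord cR addnK.
Qed.

Section SizeDependence.
Variables lambda m x r : nat.
Notation D := (Dowling lambda x m r).

Definition depends_on_sizes n := forall (T : finType) (R A : {set T}),
  R \subset A -> #|R| = r -> #|A :\: R| = n ->
  weighted_partitions (block_weight lambda m x R) A = D n.

(** [dowling_weight_rec] once the weighted sums over the smaller sets are known.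
It serves both in the induction for [depends_on_sizes] and in the theorem. *)
Lemma dowling_weight_step n (T : finType) (R A : {set T}) :
  (forall k, k <= n -> depends_on_sizes k) ->
  R \subset A -> #|R| = r -> #|A :\: R| = n.+1 ->
  weighted_partitions (block_weight lambda m x R) A =
    r * D n + x * lambda * \sum_(0 <= i < n.+1) 'C(n, i) * m ^ i * D (n - i).
Proof.
move=> IH sRA cR cAR.
have /set0Pn[a aAR]: A :\: R != set0 by rewrite -card_gt0 cAR.
have cU: #|A :\: R :\ a| = n by move: cAR; rewrite (cardsD1 a) aAR => -[].
have DaR: A :\ a :\: R = A :\: R :\ a by rewrite !setDDl setUC.
have sRAa: R \subset A :\ a by rewrite subsetD1 sRA; case/setDP: aAR.
rewrite (dowling_weight_rec _ _ _ sRA aAR) cR (IH n) ?DaR //.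
congr (_ + _ * _).
transitivity (\sum_(C : {set T} | C \subset A :\: R :\ a)
                m ^ #|C| * D (n - #|C|)).
  apply: eq_bigr => C sCU; congr (_ * _); apply: IH => //; first exact: leq_subr.
    rewrite subsetD sRAa disjoint_sym.
    by move: sCU; rewrite -DaR subsetD => /andP[].
  by rewrite setDDl setUC -setDDl DaR cardsD (setIidPr sCU) cU.
rewrite (sum_subset_card _ (fun i => m ^ i * D (n - i))) cU.
by apply: eq_bigr => i _; rewrite mulnA.
Qed.

(** Two sets of the same sizes, here A and the ground set which defines D n, satisfy
the same recurrence in terms of smaller values of D. *)
Lemma Dowling_depends_on_sizes n : depends_on_sizes n.
Proof.
elim/ltn_ind: n => n IH T R A sRA cR cAR.
have [R0 [cR0 cAR0 ->]] := weighted_ground_set lambda m x r n.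
case: n => [|n] in IH cAR R0 cR0 cAR0 *.
  have sub (U : finType) (S B : {set U}) : #|B :\: S| = 0 -> B \subset S.
    by move/eqP; rewrite cards_eq0 setD_eq0.
  by rewrite !dowling_weight_distinguished //; apply: sub.
by rewrite !(@dowling_weight_step n) ?subsetT.
Qed.

End SizeDependence.

Theorem theorem3p1 (n lambda r m x : nat) (hm : 1 <= m) (hx : 1 <= x) :
  Dowling lambda x m r n.+1 =
    r * Dowling lambda x m r n
    + x * lambda * \sum_(0 <= i < n.+1) 'C(n, i) * m ^ i * Dowling lambda x m r (n - i).
Proof.
have [R [cR cTR ->]] := weighted_ground_set lambda m x r n.+1.
apply: dowling_weight_step; rewrite ?subsetT // => k _.
exact: Dowling_depends_on_sizes.
Qed.
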